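(* Let $\mathbb{K}$ be a field and let $X\subset\mathbb{P}^{k-1}$ be a finite set of $n\geq k\geq 3$ distinct $\mathbb{K}$-rational points in general linear position. Let $a$ be an integer with $1\leq a\leq s(X)-1$. Then either $$d(X)_a\leq k-1 \quad\text{or}\quad d(X)_a\geq (k-1)(s(X)-1-a)+2.$$
   Context: $R=\mathbb{K}[x_1,\ldots,x_k]$ is the polynomial ring with the standard grading and $R_a$ is the $\mathbb{K}$-vector space of homogeneous polynomials of degree $a$. For a finite set of $\mathbb{K}$-rational points $X=\{P_1,\ldots,P_n\}\subset\mathbb{P}^{k-1}$, $I(X)\subset R$ is its (homogeneous) defining ideal, i.e. the ideal generated by all forms vanishing at every point of $X$. General linear position: $X$ is in general linear position if for every $u\leq k$, any $u$ points of $X$ span a $\mathbb{P}^{u-1}$; equivalently, representatives in $\mathbb{K}^k$ of any $u\leq k$ points of $X$ are linearly independent. Minimum distance: fix for each $P_i$ the representative in $\mathbb{K}^k$ whose leftmost nonzero coordinate is $1$. The evaluation code of order $a$ associated to $X$ is the image $\mathcal{C}(X)_a\subset\mathbb{K}^n$ of the linear map $R_a\to\mathbb{K}^n$, $f\mapsto (f(P_1),\ldots,f(P_n))$. Its minimum (Hamming) distance is denoted $d(X)_a$. Equivalently, $d(X)_a$ is the minimum, over all $f\in R_a\setminus I(X)$, of the number of points of $X$ at which $f$ does not vanish. Minimum socle degree $s(X)$: choose a linear form $L$ with $L(P_i)\neq 0$ for all $i$ (if $\mathbb{K}$ is too small for such an $L$ to exist, extend scalars to the algebraic closure $\overline{\mathbb{K}}$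 and take $L$ with coefficients in $\overline{\mathbb{K}}$). Then $B=R/\langle I(X),L\rangle$ is a graded Artinian ring; its socle is $\mathrm{Soc}(B)=\{b\in B: x_l b=0 \text{ for all } l=1,\ldots,k\}$, a graded module, and $s(X)$ is the smallest degree of a nonzero homogeneous element of $\mathrm{Soc}(B)$. This does not depend on $L$: equivalently, $R/I(X)$ has a minimal graded free resolution over $R$ of length $k-1$, and if its last module is $\bigoplus_{j=1}^t R(-b_j)$ with $b_1\leq\cdots\leq b_t$, then $s(X)=b_1-(k-1)$. *)

(* Defs.v *)
(* MathComp + multinomials *)
From mathcomp Require Import all_boot all_order all_algebra.
From mathcomp Require Import mpoly.

Set Implicit Arguments.
Unset Strict Implicit.
Unset Printing Implicit Defensive.

Import GRing.Theory.

Local Open Scope ring_scope.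

(* A point of P^{k-1} is represented by its unique representative in K^k whose
   leftmost nonzero coordinate is 1, so that distinct points are distinct
   vectors. *)
Definition normalized (K : fieldType) (k : nat) (v : 'rV[K]_k) : Prop :=
  exists2 j : 'I_k, v 0 j = 1 & forall i : 'I_k, (i < j)%N -> v 0 i = 0.

Definition ev (K : fieldType) (k : nat) (f : {mpoly K[k]}) (v : 'rV[K]_k) : K :=
  f.@[fun j : 'I_k => v 0 j].

Definition general_linear_position (K : fieldType) (k n : nat)
    (P : 'I_n -> 'rV[K]_k) : Prop :=
  forall (u : nat) (t : 'I_u -> 'I_n),
    (u <= k)%N -> injective t -> row_free (\matrix_(i < u) P (t i)).

Definition ideal_generated (K : fieldType) (k : nat) (S : {mpoly K[k]} -> Prop)
    (f : {mpoly K[k]}) : Prop :=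
  exists (m : nat) (c g : 'I_m -> {mpoly K[k]}),
    (forall i, S (g i)) /\ f = \sum_(i < m) c i * g i.

Definition vanishing_ideal (K : fieldType) (k n : nat) (P : 'I_n -> 'rV[K]_k) :
    {mpoly K[k]} -> Prop :=
  ideal_generated (fun f =>
    (exists d : nat, f \is d.-homog) /\ forall i, ev f (P i) = 0).

Definition evaluation_code (K : fieldType) (k n : nat) (P : 'I_n -> 'rV[K]_k)
    (e : nat) (c : 'rV[K]_n) : Prop :=
  exists2 f : {mpoly K[k]}, f \is e.-homog & c = \row_(i < n) ev f (P i).

Definition hamming_dist (K : fieldType) (n : nat) (c c' : 'rV[K]_n) : nat :=
  #|[set i : 'I_n | c 0 i != c' 0 i]|.

Definition is_min_distance (K : fieldType) (n : nat) (C : 'rV[K]_n -> Prop)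
    (d : nat) : Prop :=
  (exists c c', [/\ C c, C c', c <> c' & hamming_dist c c' = d]) /\
  (forall c c', C c -> C c' -> c <> c' -> (d <= hamming_dist c c')%N).

(* The next four definitions take a field extension iota : K -> F, used below
   with F = K and with F an algebraic closure of K. *)

(* L is a linear form over F that vanishes at no point of X. *)
Definition avoiding_form (K F : fieldType) (iota : {rmorphism K -> F})
    (k n : nat) (P : 'I_n -> 'rV[K]_k) (L : {mpoly F[k]}) : Prop :=
  L \is 1.-homog /\ forall i, ev L (map_mx iota (P i)) != 0.

(* The ideal <I(X), L> of F[x_1, ..., x_k], whose quotient is the Artinian
   ring B. *)
Definition artinian_ideal (K F : fieldType) (iota : {rmorphism K -> F})
    (k n : nat) (P : 'I_n -> 'rV[K]_k) (L : {mpoly F[k]}) :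
    {mpoly F[k]} -> Prop :=
  ideal_generated (fun g =>
    (exists2 f, vanishing_ideal P f & g = map_mpoly iota f) \/ g = L).

(* Elements of B are handled through representatives: the class of the form b
   is a nonzero element of Soc(B) of degree d. *)
Definition socle_form (K F : fieldType) (iota : {rmorphism K -> F})
    (k n : nat) (P : 'I_n -> 'rV[K]_k) (L : {mpoly F[k]}) (d : nat)
    (b : {mpoly F[k]}) : Prop :=
  [/\ b \is d.-homog,
      ~ artinian_ideal iota P L b
    & forall l : 'I_k, artinian_ideal iota P L ('X_l * b)].

Definition is_min_socle_degree_of (K F : fieldType) (iota : {rmorphism K -> F})
    (k n : nat) (P : 'I_n -> 'rV[K]_k) (L : {mpoly F[k]}) (s : nat) : Prop :=
  (exists b, socle_form iota P L s b) /\
  (forall d b, socle_form iota P L d b -> (s <= d)%N).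

(* s(X) is a relation because a form L has to be chosen: over K if possible,
   otherwise over an algebraic closure F of K. *)
Definition is_min_socle_degree (K : fieldType) (k n : nat)
    (P : 'I_n -> 'rV[K]_k) (s : nat) : Prop :=
  (exists2 L : {mpoly K[k]},
     avoiding_form idfun P L & is_min_socle_degree_of idfun P L s) \/
  ((~ exists L : {mpoly K[k]}, avoiding_form idfun P L) /\
   exists (F : closedFieldType) (iota : {rmorphism K -> F}),
     (forall x : F, algebraicOver iota x) /\
     exists2 L : {mpoly F[k]},
       avoiding_form iota P L & is_min_socle_degree_of iota P L s).

(* Main.v *)
(* Let f be a form of degree a nonzero at exactly the d points of a subset Y of
   X, and let P be in Y.  If d - 1 <= (k - 1)(s - 1 - a), general position covers
   Y minus P by s - 1 - a hyperplanes avoiding P, so f times their equations is a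
   form of degree s - 1 vanishing on X except at P (a separator of P).  But a
   separator h of P of minimal degree is a socle element of B: x_l h is
   proportional to L h modulo I(X), and h in <I(X), L> would yield a separator
   of smaller degree.  So separators have degree at least s. *)
Require Import Defs.
From mathcomp Require Import all_boot all_order all_algebra.
From mathcomp Require Import mpoly.
From mathcomp Require Import ring zify.

Set Implicit Arguments.
Unset Strict Implicit.
Unset Printing Implicit Defensive.

Import GRing.Theory.

Local Open Scope ring_scope.

(** * Evaluation at points and homogeneous components *)

Section Evaluation.
Variables (K : fieldType) (k : nat).
Implicit Types (f g : {mpoly K[k]}) (v : 'rV[K]_k).

Lemma evD f g v : ev (f + g) v = ev f v + ev g v.
Proof. exact: mevalD. Qed.

Lemma evB f g v : ev (f - g) v = ev f v - ev g v.
Proof. exact: mevalB. Qed.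

Lemma evM f g v : ev (f * g) v = ev f v * ev g v.
Proof. exact: mevalM. Qed.

Lemma evZ c f v : ev (c *: f) v = c * ev f v.
Proof. exact: mevalZ. Qed.

Lemma evX j v : ev 'X_j v = v 0 j.
Proof. exact: mevalXU. Qed.

Lemma ev_sum (I : Type) (r : seq I) (F : I -> {mpoly K[k]}) v :
  ev (\sum_(i <- r) F i) v = \sum_(i <- r) ev (F i) v.
Proof. by rewrite /ev raddf_sum. Qed.

Lemma dhomogXU j : ('X_j : {mpoly K[k]}) \is 1.-homog.
Proof. by rewrite dhomogX /= mdeg1. Qed.

(** Lets one degree be extracted from an ideal combination whose coefficients are arbitrary but
    whose generators are forms; by linearity it is enough to treat a monomial [p]. *)
Lemma pihomogMr d e (p q : {mpoly K[k]}) : q \is d.-homog ->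
  pihomog mdeg e (p * q) =
  (if (d <= e)%N then pihomog mdeg (e - d) p * q else 0 : {mpoly K[k]}).
Proof.
move=> hq; elim/mpolyind: p => [|c m p _ _ IH].
  by rewrite mul0r !linear0 mul0r if_same.
rewrite mulrDl linearD /= IH -scalerAl linearZ /= linearD linearZ /= pihomogX.
have hm : 'X_[m] * q \is (mdeg m + d).-homog by apply: dhomogM; rewrite ?dhomogX.
have [eme|nme] := eqVneq (mdeg m + d)%N e.
  rewrite pihomog_dE -?eme // leq_addl addnK eqxx.
  by rewrite mulrDl -scalerAl.
rewrite (pihomog_ne0 nme hm) scaler0 add0r.
case: leqP => // led; rewrite -(eqn_add2r d) subnK // (negPf nme).
by rewrite scaler0 add0r.
Qed.

End Evaluation.

(** * Extension of scalars *)

Section BaseChange.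
Variables (K F : fieldType) (iota : {rmorphism K -> F}) (k : nat).

Lemma ev_map (f : {mpoly K[k]}) (v : 'rV[K]_k) :
  ev (map_mpoly iota f) (map_mx iota v) = iota (ev f v).
Proof.
elim/mpolyind: f => [|c m f _ _ IH]; first by rewrite /ev !raddf0.
rewrite rmorphD /= map_mpolyZ map_mpolyX !evD !evZ rmorphD rmorphM IH.
congr (_ * _ + _); rewrite /ev !mevalX rmorph_prod /=.
by apply: eq_bigr => j _; rewrite mxE rmorphXn.
Qed.

Lemma dhomog_map d (f : {mpoly K[k]}) :
  f \is d.-homog -> map_mpoly iota f \is d.-homog.
Proof.
move=> /dhomogP hf; apply/dhomogP => m.
by rewrite (perm_mem (msupp_map_mpoly _ (fmorph_inj iota))) => /hf.
Qed.

End BaseChange.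

(** * Closure properties of generated ideals *)

Section IdealGenerated.
Variables (K : fieldType) (k : nat) (S : {mpoly K[k]} -> Prop).

Lemma ideal_generated_gen g : S g -> ideal_generated S g.
Proof.
move=> Sg; exists 1%N, (fun=> 1), (fun=> g).
by split=> //; rewrite big_ord1 mul1r.
Qed.

Lemma ideal_generated0 : ideal_generated S 0.
Proof. by exists 0%N, (fun=> 0), (fun=> 0); split=> [[]//|]; rewrite big_ord0. Qed.

Lemma ideal_generatedD f g :
  ideal_generated S f -> ideal_generated S g -> ideal_generated S (f + g).
Proof.
move=> [m1 [c1 [g1 [S1 ->]]]] [m2 [c2 [g2 [S2 ->]]]].
pose glue (u : 'I_m1 -> {mpoly K[k]}) (v : 'I_m2 -> {mpoly K[k]}) i :=
  match split i with inl j => u j | inr j => v j end.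
exists (m1 + m2)%N, (glue c1 c2), (glue g1 g2); split=> [i|].
  by rewrite /glue; case: (split i).
rewrite big_split_ord /glue; congr (_ + _); apply: eq_bigr => i _.
  by rewrite (unsplitK (inl i)).
by rewrite (unsplitK (inr i)).
Qed.

Lemma ideal_generatedM c f : ideal_generated S f -> ideal_generated S (c * f).
Proof.
move=> [m [c1 [g1 [S1 ->]]]]; exists m, (fun i => c * c1 i), g1; split=> //.
by rewrite mulr_sumr; apply: eq_bigr => i _; rewrite mulrA.
Qed.

Lemma ideal_generatedZ c f : ideal_generated S f -> ideal_generated S (c *: f).
Proof. by rewrite -mul_mpolyC; apply: ideal_generatedM. Qed.

End IdealGenerated.

(** * Separators and the socle of the Artinian reduction *)

Definition separator (K : fieldType) (k n : nat) (P : 'I_n -> 'rV[K]_k)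
    (i0 : 'I_n) (e : nat) (h : {mpoly K[k]}) : Prop :=
  [/\ h \is e.-homog, ev h (P i0) != 0 & forall i, i != i0 -> ev h (P i) = 0].

Section Separators.
Variables (K F : fieldType) (iota : {rmorphism K -> F}).
Variables (k n : nat) (P : 'I_n -> 'rV[K]_k).

Lemma separator_map i0 e h : separator P i0 e h ->
  separator (fun i => map_mx iota (P i)) i0 e (map_mpoly iota h).
Proof.
move=> [hh h0 hi]; split=> [||i /hi]; rewrite ?dhomog_map ?ev_map ?fmorph_eq0 //.
by move=> ->; rewrite rmorph0.
Qed.

(* Solvability of a linear system with coefficients in K does not depend on
   the field in which solutions are sought. *)
Lemma separator_descent i0 e (h : {mpoly F[k]}) :
  separator (fun i => map_mx iota (P i)) i0 e h -> exists g, separator P i0 e g.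
Proof.
move=> [hh h0 hi].
pose r := in_tuple (msupp h).
(* Values on X of the monomials of [h] only, so that every combination of them is again a form of
   degree [e]. *)
pose M := \matrix_(j < size (msupp h), i < n) ev 'X_[tnth r j] (P i) : 'M[K]_(_, _).
have evh i : ev h (map_mx iota (P i)) =
    ((\row_j h@_(tnth r j)) *m map_mx iota M) 0 i.
  rewrite {1}(mpolyE h) ev_sum (big_tnth _ _ (msupp h)) mxE.
  apply: eq_bigr => j _; rewrite evZ !mxE -ev_map map_mpolyX.
  by congr (_ * _).
(* The rescaled coefficients of [h] prove this membership over [F]; row space inclusion is
   insensitive to field extension. *)
have : ((delta_mx 0 i0 : 'rV[K]_n) <= M)%MS.
  rewrite -(map_submx iota) map_delta_mx.
  apply/submxP; exists ((ev h (map_mx iota (P i0)))^-1 *: (\row_j h@_(tnth r j))).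
  rewrite -scalemxAl; apply/rowP => i; rewrite 2!mxE -evh eqxx /=.
  by case: eqVneq => [->|/hi ->]; rewrite ?mulVf ?mulr0.
case/submxP => D /rowP eqD.
have evg i : ev (\sum_j D 0 j *: 'X_[tnth r j]) (P i) = (i == i0)%:R.
  have := eqD i; rewrite mxE eqxx /= => ->.
  by rewrite ev_sum mxE; apply: eq_bigr => j _; rewrite evZ mxE.
exists (\sum_j D 0 j *: 'X_[tnth r j]); split=> [||i /negPf ni].
- apply: rpred_sum => j _; apply: rpredZ; rewrite dhomogX.
  by rewrite (dhomog_mf hh) ?mem_tnth.
- by rewrite evg eqxx oner_neq0.
- by rewrite evg ni.
Qed.

(* Expanded over the coefficients of L, with P = P_i0, this is a combination of
   the forms (P_j x_l - P_l x_j) h, which vanish on X and are defined over K. *)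
Lemma separator_proportional (S : {mpoly F[k]} -> Prop) i0 e h (l : 'I_k)
    (L : {mpoly F[k]}) :
  (forall f, vanishing_ideal P f -> S (map_mpoly iota f)) ->
  separator P i0 e h -> L \is 1.-homog ->
  ideal_generated S (ev L (map_mx iota (P i0)) *: ('X_l * map_mpoly iota h)
                     - iota (P i0 0 l) *: (L * map_mpoly iota h)).
Proof.
move=> SI [hh h0 hi] /dhomogP hL.
rewrite (mpolyE L) ev_sum scaler_suml mulr_suml scaler_sumr -sumrB.
rewrite big_seq; elim/big_rec: _ => [|m x m_in]; first exact: ideal_generated0.
apply: ideal_generatedD.
have /eqP := hL _ m_in; rewrite /= => /mdeg1P [j /eqP ->].
set c := L@_ _; rewrite evZ evX mxE.
suff : ideal_generated S
    (map_mpoly iota ((P i0 0 j *: 'X_l - P i0 0 l *: 'X_j) * h)).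
  move=> /(ideal_generatedZ c); congr (ideal_generated _ _).
  rewrite rmorphM rmorphB /= !map_mpolyZ !map_mpolyX -!mul_mpolyC rmorphM /=.
  ring.
apply: ideal_generated_gen; apply: SI; apply: ideal_generated_gen.
split=> [|i].
  exists (1 + e)%N; apply: dhomogM => //.
  by apply: rpredB; apply: rpredZ; apply: dhomogXU.
rewrite evM evB !evZ !evX.
case: (eqVneq i i0) => [->|/hi ->]; last by rewrite mulr0.
by rewrite mulrC [X in _ - X]mulrC subrr mulr0.
Qed.

(** Modulo the ideal, [L * h] is zero, and the factor L(P_i0) in the proportionality relation is
    invertible. *)
Lemma separator_socle i0 e h L l : separator P i0 e h ->
  avoiding_form iota P L -> artinian_ideal iota P L ('X_l * map_mpoly iota h).
Proof.
move=> seph [hL /(_ i0) L0].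
set A := artinian_ideal _ _ _.
have AH : A (ev L (map_mx iota (P i0)) *: ('X_l * map_mpoly iota h)
          - iota (P i0 0 l) *: (L * map_mpoly iota h)).
  by apply: separator_proportional seph hL => f If; left; exists f.
have AL : A L by apply: ideal_generated_gen; right.
have := ideal_generatedZ (ev L (map_mx iota (P i0)))^-1
  (ideal_generatedD AH (ideal_generatedZ (iota (P i0 0 l))
    (ideal_generatedM (map_mpoly iota h) AL))).
by rewrite [L * _]mulrC subrK scalerA mulVf // scale1r.
Qed.

(* As e - 1 is truncated, e = 0 is treated apart. *)
Lemma artinian_ideal_component L e g : L \is 1.-homog ->
  artinian_ideal iota P L g ->
  exists q : {mpoly F[k]},
    [/\ q \is e.-1.-homog, e = 0%N -> q = 0
      & forall i, ev (pihomog mdeg e g) (map_mx iota (P i)) =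
                  ev L (map_mx iota (P i)) * ev q (map_mx iota (P i))].
Proof.
move=> hL [m [c [gen [hgen ->]]]]; rewrite linear_sum /=.
(* Terms from I(X) vanish on X in each degree; [q] sums the components of degree e - 1 of the
   coefficients of [L]. *)
elim/big_rec: _ => [|j p _ [q [hq q0 evq]]].
  by exists 0; split=> [||i] //; rewrite ?rpred0 // /ev !raddf0 mulr0.
case: (hgen j) => [[f [m' [c' [g' [Ig' ->]]]] ->]|->].
  exists q; split=> // i; rewrite evD evq rmorph_sum /= mulr_sumr linear_sum /=.
  rewrite ev_sum big1 ?add0r // => j' _.
  have [[d hd] g0] := Ig' j'.
  rewrite rmorphM mulrA (pihomogMr _ _ (dhomog_map _ hd)).
  case: ifP => _; last by rewrite /ev raddf0.
  by rewrite evM ev_map g0 rmorph0 mulr0.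
rewrite (pihomogMr _ _ hL) subn1; case: e q0 evq hq => [|e] /= q0 evq hq.
  by exists q; split=> // i; rewrite add0r evq.
exists (pihomog mdeg e (c j) + q); split=> // [|i].
  by rewrite rpredD // pihomogP.
by rewrite !evD evM evq mulrDr [X in X + _]mulrC.
Qed.

(** On X, [h] agrees with [L * q], and [L] has no zero there, so [q] is a separator over [F] of
    degree one less, which descends to [K]. In degree 0, [q = 0] would contradict h(P_i0) != 0. *)
Lemma separator_artinian i0 e h L : avoiding_form iota P L ->
  separator P i0 e h -> artinian_ideal iota P L (map_mpoly iota h) ->
  exists2 g, separator P i0 e.-1 g & (0 < e)%N.
Proof.
move=> [hL L0] /separator_map[hh h0 hi] /(artinian_ideal_component e hL).
move=> [q [hq q0 evq]]; rewrite (pihomog_dE hh) in evq.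
have sepq : separator (fun i => map_mx iota (P i)) i0 e.-1 q.
  split=> // [|i /hi].
    by apply: contraNneq h0 => qz; rewrite evq qz mulr0.
  by rewrite evq => /eqP; rewrite mulf_eq0 (negPf (L0 i)) /= => /eqP.
have [g sepg] := separator_descent sepq; exists g => //.
rewrite lt0n; apply: contraNneq h0 => /q0 qz.
by rewrite evq qz /ev raddf0 mulr0.
Qed.

(* A separator of minimal degree is a socle form. *)
Lemma min_socle_degree_le_separator i0 s L e h : avoiding_form iota P L ->
  is_min_socle_degree_of iota P L s -> separator P i0 e h -> (s <= e)%N.
Proof.
(* Strong induction replaces the choice of a separator of minimal degree. *)
move=> aL [_ smin]; elim/ltn_ind: e h => e IH h seph.
rewrite leqNgt; apply/negP => lt_es.
suff : (s <= e)%N by rewrite leqNgt lt_es.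
apply: (smin e (map_mpoly iota h)); split.
- by case: seph => hh _ _; apply: dhomog_map.
- move=> /(separator_artinian aL seph)[g sepg e0].
  have ltp : (e.-1 < e)%N by rewrite prednK.
  by have := IH _ ltp _ sepg; rewrite leqNgt (ltn_trans ltp lt_es).
- by move=> l; apply: separator_socle seph aL.
Qed.

End Separators.

(** * Hyperplanes through points in general linear position *)

Section GeneralPosition.
Variables (K : fieldType) (k n : nat) (P : 'I_n -> 'rV[K]_k).
Hypothesis glpP : general_linear_position P.

(** The points of [B] together with P_i0 number at most [k], hence are linearly independent, and a
    linear form can take prescribed values at them. *)
Lemma separating_hyperplane (B : {set 'I_n}) i0 :
  (#|B| < k)%N -> i0 \notin B ->
  exists l : {mpoly K[k]}, [/\ l \is 1.-homog, ev l (P i0) != 0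
    & forall i, i \in B -> ev l (P i) = 0].
Proof.
move=> ltBk i0B; pose A := i0 |: B.
have leAk : (#|A| <= k)%N by rewrite cardsU1 i0B.
have i0A : i0 \in A by rewrite setU11.
have := mulmxVp (glpP leAk (@enum_val_inj _ (mem A))).
set M := \matrix_(i < _) _ => MV.
(* The column at [i0] of a right inverse of [M]: coefficients of the form that is 1 at P_i0 and 0 on
   [B]. *)
pose v := pinvmx M *m delta_mx (enum_rank_in i0A i0) 0 : 'cV_k.
have evA i : i \in A -> ev (\sum_j v j 0 *: 'X_j) (P i) = (i == i0)%:R.
  move=> iA; have /matrixP /(_ (enum_rank_in i0A i) 0) :
    M *m v = delta_mx (enum_rank_in i0A i0) 0 by rewrite mulmxA MV mul1mx.
  rewrite !mxE eqxx andbT (inj_in_eq (@enum_rank_in_inj _ _ _ _ _ _)) // => <-.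
  rewrite ev_sum; apply: eq_bigr => j _.
  by rewrite evZ evX !mxE enum_rankK_in // mulrC.
exists (\sum_j v j 0 *: 'X_j); split=> [||i iB].
- by apply: rpred_sum => j _; apply: rpredZ; apply: dhomogXU.
- by rewrite evA // eqxx oner_neq0.
- rewrite evA ?inE ?iB ?orbT //.
  by case: eqVneq iB i0B => // -> ->.
Qed.

Lemma separating_form e (A : {set 'I_n}) i0 :
  (0 < k)%N -> (#|A| <= (k - 1) * e)%N -> i0 \notin A ->
  exists f : {mpoly K[k]}, [/\ f \is e.-homog, ev f (P i0) != 0
    & forall i, i \in A -> ev f (P i) = 0].
Proof.
move=> k_gt0; elim: e A => [|e IH] A.
  rewrite muln0 leqn0 cards_eq0 => /eqP -> _; exists 1.
  by split=> [||i]; rewrite ?dhomog1 ?inE // /ev meval1 oner_neq0.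
move=> leA i0A.
(* One hyperplane absorbs k - 1 points of [A], or all of [A] if fewer remain. *)
have [B sBA cB] : exists2 B : {set _}, B \subset A & #|B| = minn #|A| (k - 1).
  have /card_geqP[r [uniq_r <- rA]] := geq_minl #|A| (k - 1).
  exists [set x in r]; first by apply/subsetP => x; rewrite inE => /rA.
  by rewrite cardsE; apply/card_uniqP.
have [||l [hl l0 lB]] := @separating_hyperplane B i0.
- by rewrite cB; lia.
- by apply: contra i0A; apply: (subsetP sBA).
have [||f [hf f0 fA]] := IH (A :\: B).
- by rewrite cardsD (setIidPr sBA) cB leq_subLR addn_minl leq_min leq_addr -mulnS.
- by rewrite inE negb_and i0A orbT.
exists (l * f); split=> [||i iA].
- by rewrite -add1n dhomogM.
- by rewrite evM mulf_neq0.
rewrite evM; case: (boolP (i \in B)) => [/lB ->|niB]; first by rewrite mul0r.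
by rewrite fA ?mulr0 // inE niB.
Qed.

End GeneralPosition.

(** * From a codeword of small weight to a separator of degree s - 1 *)

Theorem theorem4p2 (K : fieldType) (k n : nat) (hk : (3 <= k)%N)
    (hn : (k <= n)%N) (P : 'I_n -> 'rV[K]_k)
    (hPnorm : forall i, normalized (P i)) (hPdist : injective P)
    (hPglp : general_linear_position P)
    (s : nat) (hs : is_min_socle_degree P s)
    (a : nat) (ha1 : (1 <= a)%N) (has : (a <= s - 1)%N)
    (d : nat) (hd : is_min_distance (evaluation_code P a) d) :
  (d <= k - 1)%N \/ ((k - 1) * (s - 1 - a) + 2 <= d)%N.
Proof.
right; rewrite leqNgt; apply/negP => ltd.
have sep_ge i0 e h : separator P i0 e h -> (s <= e)%N.
  (* The degree bound holds over any extension, so it covers [L] over [K] as well as over the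
     closure. *)
  case: hs => [[L aL minL]|[_ [F [iota [_ [L aL minL]]]]]];
    exact: (min_socle_degree_le_separator aL minL).
case: hd => [[c [c' [[f hf ->] [f' hf' ->] neq_ff' <-]]] _] in ltd.
rewrite /hamming_dist in ltd; set Y := [set i | _] in ltd.
(* By linearity, two codewords at distance [d] amount to the single form [f - f'], nonzero exactly
   on [Y]. *)
have YE i : (i \in Y) = (ev (f - f') (P i) != 0).
  by rewrite inE !mxE evB subr_eq0.
have [i0 i0Y] : exists i0, i0 \in Y.
  apply/set0Pn/eqP => Y0; apply: neq_ff'; apply/rowP => i; rewrite !mxE.
  by apply/eqP; rewrite -subr_eq0 -evB -[_ == 0]negbK -YE Y0 inE.
(* Removing [i0] leaves d - 1 points to cover; this accounts for the + 2 in the bound. *)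
have [|||g [hg g0 gY]] := @separating_form _ _ _ _ hPglp (s - 1 - a) (Y :\ i0) i0.
- by lia.
- by move: ltd; rewrite (cardsD1 i0) i0Y add1n addn2 !ltnS.
- by rewrite !inE eqxx.
have sep : separator P i0 (a + (s - 1 - a)) ((f - f') * g).
  split=> [||i ni].
  - by apply: dhomogM => //; apply: rpredB.
  - by rewrite evM mulf_neq0 // -YE.
  - rewrite evM; case: (boolP (i \in Y)) => [iY|].
      by rewrite gY ?mulr0 //; apply/setD1P.
    by rewrite YE negbK => /eqP ->; rewrite mul0r.
(* As 1 <= a <= s - 1, no subtraction truncates: the degree is s - 1, below [s]. *)
by have := sep_ge _ _ _ sep; lia.
Qed.
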